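(* Let $n\ge 2$, let $f$ be a real-valued function of two real variables $x,y$ that is $n$ times continuously differentiable in a neighbourhood of a point $(x_0,y_0)$, with $f(x_0,y_0)=0$ and $f_y(x_0,y_0)\neq 0$, and let $y=y(x)$ be the function defined near $x_0$ by $f(x,y(x))=0$ and $y(x_0)=y_0$. Then, for every $x$ in a neighbourhood of $x_0$ (all derivatives of $f$ being evaluated at $(x,y(x))$), \[y^{(n)}=\sum_{\alpha\in A_n}\frac{(-1)^{\sum_{l+r\ge2}m_{l,r}}\,n!\,\big(\sum_{l+r\ge2}r\,m_{l,r}\big)!}{\prod_{l+r\ge2}l!^{m_{l,r}}\,r!^{m_{l,r}}\,m_{l,r}!}\cdot\frac{\prod_{l+r\ge2}(\Delta_l f_{y^r})^{m_{l,r}}}{f_y^{\,n+\sum_{l+r\ge2}m_{l,r}}},\] where $\alpha=\{m_{l,r}\}_{l+r\ge 2}$.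
   Context: Indices $x,y$ denote partial derivatives, and $g_{x^py^r}=\frac{\partial^{p+r}g}{\partial x^p\partial y^r}$; $y^{(n)}=\frac{d^ny}{dx^n}$. For a smooth enough function $g$ of $x,y$ and an integer $l\ge0$, \[\Delta_l g=\sum_{j=0}^{l}(-1)^j\binom{l}{j}\,g_{x^{l-j}y^j}\,f_x^{\,j}f_y^{\,l-j}.\] The index precedes the $\Delta$-sign: $\Delta_l f_{y^r}$ means $\Delta_l(f_{y^r})$. $A_n$ is the set of families $\alpha=\{m_{l,r}\}_{l+r\ge2}$ of non-negative integers, indexed by pairs of non-negative integers $(l,r)$ with $l+r\ge2$, satisfying $\sum_{l+r\ge2}l\,m_{l,r}=n$ and $\sum_{l+r\ge2}(r-1)\,m_{l,r}=-1$. (Such families have only finitely many non-zero entries.) *)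

(* Defs.v *)
From Stdlib Require Export Reals.
From Coquelicot Require Export Coquelicot.
From mathcomp Require Export all_boot all_algebra finmap.
From mathcomp Require Export boolp classical_sets fsbigop Rstruct.

Set Implicit Arguments.
Unset Strict Implicit.
Unset Printing Implicit Defensive.

Import GRing.Theory Num.Theory.
Local Open Scope ring_scope.

(* The reals are those of the standard library; limits and derivatives are
   Coquelicot's, ring operations and iterated sums are MathComp's. *)

(* [partial_derive p r g] differentiates [r] times in the second variable, then
   [p] times in the first one. *)
Definition Delta (f : R -> R -> R) (l : nat) (g : R -> R -> R) (x y : R) : R :=
  \sum_(j < l.+1) (-1) ^+ j * 'C(l, j)%:R * partial_derive (l - j) j g x y
    * partial_derive 1 0 f x y ^+ j * partial_derive 0 1 f x y ^+ (l - j).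

(* A family indexed by the pairs (l, r) with l + r >= 2 is represented by its
   extension by zero to all pairs; the support is finite by typing. *)
Definition index_family := {fsfun nat * nat -> nat with 0%N}.

(* The second sum is taken in [int], where [r - 1] can be negative. *)
Definition An (n : nat) : set index_family :=
  [set m : index_family |
    [/\ forall p, p \in finsupp m -> (2 <= p.1 + p.2)%N,
        (\sum_(p <- finsupp m) p.1 * m p = n)%N &
        \sum_(p <- finsupp m) (p.2%:Z - 1) * (m p)%:Z = -1]].

(* Continuity at [x0] selects the branch through (x0, y0): without it, [y] could
   jump to other zeros of [f x]. Together with the other two conditions it
   determines [y] near [x0] when the implicit function theorem applies. *)
Definition implicit_function (f : R -> R -> R) (x0 y0 : R) (y : R -> R) : Prop :=
  [/\ y x0 = y0, continuous y x0 & locally x0 (fun x => f x (y x) = 0)].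

(* The [%R] delimiter, which here stands for [ring_scope], keeps the result type
   [R] from reading the operations in [R_scope].
   Indices outside the support of [m] would only contribute factors 1 to the
   products and 0 to the sums. *)
Definition implicit_term (f : R -> R -> R) (n : nat) (m : index_family) (x y : R) : R :=
  let M := (\sum_(p <- finsupp m) m p)%N in
  (((-1) ^+ M * n`!%:R * (\sum_(p <- finsupp m) p.2 * m p)%N`!%:R)
    / (\prod_(p <- finsupp m) (p.1`! ^ m p * p.2`! ^ m p * (m p)`!))%N%:R
  * ((\prod_(p <- finsupp m) Delta f p.1 (partial_derive 0 p.2 f) x y ^+ m p)
    / partial_derive 0 1 f x y ^+ (n + M)))%R.

(* Main.v *)
Require Import Defs.
From Stdlib Require Import Lra.
From mathcomp Require Import functions cardinality multiset zify.

Set Implicit Arguments.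
Unset Strict Implicit.
Unset Printing Implicit Defensive.

Import GRing.Theory Num.Theory.
Local Open Scope classical_set_scope.
Local Open Scope mset_scope.
Local Open Scope ring_scope.

(** The formula is proved by induction on the order: the derivative of the
    expression for [y^(k)] is the expression for [y^(k+1)].

    Let [q = y' = - f_x / f_y], and write [c_(l,r) = (d_x + q d_y)^l d_y^r f]
    for the derivatives in which [q] is treated as a constant, evaluated at
    [(x, y x)].  Expanding the power gives
    [Delta_l f_(y^r) = f_y ^ l * c_(l,r)] ([Delta_frozen]), so with
    [a_(l,r) = c_(l,r) / (l! r! f_y)] the right-hand side of the theorem is
    [n!] times the sum over [An n] of
    [(-1)^|m| R(m)! * prod_p a_p ^ m_p / m_p!], where [|m|] is the sum of the
    [m_p] and [R(m)] that of the [r m_(l,r)] ([implicit_termE]).  This is the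
    coefficient that Lagrange inversion gives for the solution [t] of
    [t = - sum_(l+r >= 2) a_(l,r) s^l t^r], whence the name [lagrange_sum].

    Differentiating [c_(l,r)] along the curve also moves the frozen [q], and
    [q' = - c_(2,0) / f_y]; therefore
    [a_(l,r)' = (l+1) a_(l+1,r) - 2 (r+1) a_(2,0) a_(l-1,r+1) - a_(1,1) a_(l,r)]
    ([is_derive_taylor_coef]).  By the Leibniz rule the derivative of the sum
    over [An k] is a sum over the ways of removing one pair [p] from a family
    and replacing it by the three terms above.  Relabelling the removed pair
    shows that the first term produces each [mu] of [An k.+1] with factor
    [sum_p l_p mu_p = k + 1], except for the contributions of [p = (2, 0)] and
    [p = (1, 1)], which come from no pair of order at least 2; these two gaps
    are filled exactly by the second and the third term
    ([leibniz_sum_derivation]).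

    It remains to know that [y] is differentiable: it is Lipschitz near [x0]
    by the mean value theorem in each variable, hence the first-order expansion
    of [f] gives [y'] ([implicit_lipschitz], [is_derive_implicit]).  The base
    of the induction is [y'' = q']. *)

(** * Implicit functions and the chain rule in the plane *)

Section ImplicitFunction.
Local Open Scope R_scope.

(** Continuous first partial derivatives give differentiability; symmetry of
    the mixed derivatives identifies the second one with
    [partial_derive i j.+1 f]. *)
Lemma differentiable_partial_derive (f : R -> R -> R) n i j u v :
  (i + j < n)%N -> locally_2d (ex_diff_n f n) u v ->
  differentiable_pt_lim (partial_derive i j f) u v
    (partial_derive i.+1 j f u v) (partial_derive i j.+1 f u v).
Proof.
move=> /ltP ij_n Hf; apply/filterdiff_differentiable_pt_lim.
have Hfuv := locally_2d_singleton _ _ _ Hf.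
apply: (is_derive_filterdiff (partial_derive i j f) u v (partial_derive i.+1 j f)).
- move/locally_2d_locally: Hf; apply: filter_imp => -[s t] /= Hst.
  apply: Derive_correct; exact: ex_diff_n_ex_deriv_inf_1 ij_n _ _ _ Hst.
- rewrite -Derive_partial_derive.
    apply: Derive_correct; exact: ex_diff_n_ex_deriv_inf_2 ij_n _ _ _ Hfuv.
  apply: locally_2d_impl Hf; apply: locally_2d_forall => s t.
  by apply: ex_diff_n_m; apply/leP; rewrite plusE addnS; apply/ltP.
- apply/continuity_2d_pt_filterlim.
  exact: ex_diff_n_continuity_inf_1 ij_n _ _ _ Hfuv.
Qed.

Lemma locally_Rabs (a r b : R) :
  Rabs (b - a) < r -> locally b (fun t => Rabs (t - a) < r).
Proof.
move=> br; have e0 : 0 < r - Rabs (b - a) by lra.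
exists (mkposreal _ e0) => t tb; have {}tb : Rabs (t - b) < r - Rabs (b - a) := tb.
have := Rabs_triang (t - b) (b - a).
by replace (t - b + (b - a)) with (t - a) by ring; lra.
Qed.

Lemma locally_Rabs_imp (a r : R) (Q : R -> Prop) : 0 < r ->
  (forall t, Rabs (t - a) < r -> Q t) -> locally a Q.
Proof. by move=> r0 H; exists (mkposreal _ r0) => t; apply: H. Qed.

Lemma locally_Rabs_ex (a : R) (Q : R -> Prop) : locally a Q ->
  exists2 r, 0 < r & forall t, Rabs (t - a) < r -> Q t.
Proof. by move=> [r Hr]; exists r => [|t tr]; [exact: cond_pos|exact: Hr]. Qed.

Lemma chain_rule_2d (g : R -> R -> R) (y : R -> R) x dg1 dg2 dy :
  differentiable_pt_lim g x (y x) dg1 dg2 -> is_derive y x dy ->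
  is_derive (fun t => g t (y t)) x (dg1 + dg2 * dy).
Proof.
move=> Hg /is_derive_Reals Hy; apply/is_derive_Reals.
have := derivable_pt_lim_comp_2d g id y x dg1 dg2 1 dy Hg (derivable_pt_lim_id x) Hy.
by rewrite Rmult_1_r.
Qed.

Lemma MVT_derivable (g dg : R -> R) (a b : R) :
  (forall t, Rmin a b <= t <= Rmax a b -> is_derive g t (dg t)) ->
  exists2 c, Rmin a b <= c <= Rmax a b & g b - g a = dg c * (b - a).
Proof.
move=> H; have [|t abt|c [abc gE]] := MVT_gen g a b dg; last by exists c.
- by move=> t abt; apply: H; lra.
- apply: derivable_continuous_pt; exists (dg t).
  exact/is_derive_Reals/H.
Qed.

Lemma between_ball (a b c r t : R) :
  Rabs (a - c) < r -> Rabs (b - c) < r -> Rmin a b <= t <= Rmax a b ->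
  Rabs (t - c) < r.
Proof. by rewrite /Rmin /Rmax; case: Rle_dec => ?; split_Rabs; lra. Qed.

(** Continuity of [y] at the single point [x0] is enough to keep the curve in a
    box where [|f_x| <= K] and [c <= |f_y|]; the mean value theorem in each
    variable then bounds its increments. *)
Lemma implicit_lipschitz (f : R -> R -> R) (y : R -> R) (x0 y0 r r' c K : R) :
  0 < c ->
  (forall u v, Rabs (u - x0) < r -> Rabs (v - y0) < r' ->
    [/\ ex_derive (fun s => f s v) u, ex_derive (fun s => f u s) v,
        Rabs (Derive (fun s => f s v) u) <= K & c <= Rabs (Derive (fun s => f u s) v)]) ->
  (forall x, Rabs (x - x0) < r -> Rabs (y x - y0) < r' /\ f x (y x) = 0) ->
  forall x x', Rabs (x - x0) < r -> Rabs (x' - x0) < r ->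
  Rabs (y x' - y x) <= K / c * Rabs (x' - x).
Proof.
move=> c0 Hf Hy x x' xr x'r.
have [yxr fx0] := Hy _ xr; have [yx'r fx'0] := Hy _ x'r.
(* From (x, y x) the point is first moved to (x', y x), then to (x', y x'). *)
have [t|eta eta_r eta_E] := @MVT_derivable (fun s => f s (y x))
  (fun u => Derive (fun s => f s (y x)) u) x x'.
  move=> /(between_ball xr x'r) tr; have [d1 _ _ _] := Hf _ _ tr yxr.
  exact: Derive_correct.
have [t|xi xi_r xi_E] := @MVT_derivable (fun s => f x' s)
  (fun v => Derive (fun s => f x' s) v) (y x) (y x').
  move=> /(between_ball yxr yx'r) tr; have [_ d2 _ _] := Hf _ _ x'r tr.
  exact: Derive_correct.
have [_ _ dK _] := Hf _ _ (between_ball xr x'r eta_r) yxr.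
have [_ _ _ dc] := Hf _ _ x'r (between_ball yxr yx'r xi_r).
move: eta_E xi_E; rewrite fx0 fx'0 => eta_E xi_E.
have E : Rabs (Derive (fun s => f x' s) xi) * Rabs (y x' - y x) =
         Rabs (Derive (fun s => f s (y x)) eta) * Rabs (x' - x).
  by rewrite -!Rabs_mult -xi_E -eta_E -Rabs_Ropp; congr Rabs; ring.
have := Rabs_pos (y x' - y x); have := Rabs_pos (x' - x).
move: E dK dc; move: (Rabs (Derive _ xi)) (Rabs (Derive _ eta)) => A B.
move: (Rabs (y x' - y x)) (Rabs (x' - x)) => Y X E BK cA X0 Y0.
apply: (Rmult_le_reg_l c) => //.
replace (c * (K / c * X)) with (K * X) by (field; lra).
nra.
Qed.

(** Along a Lipschitz curve the remainder in the first-order expansion of [f] is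
    [o(t - x)], so the linear part [d1 (t - x) + d2 (y t - y x)], which equals
    minus this remainder, is too. *)
Lemma is_derive_implicit (f : R -> R -> R) (y : R -> R) (x l d1 d2 : R) :
  locally x (fun t => f t (y t) = 0) -> d2 <> 0 ->
  locally x (fun t => Rabs (y t - y x) <= l * Rabs (t - x)) ->
  differentiable_pt_lim f x (y x) d1 d2 ->
  is_derive y x (- d1 / d2).
Proof.
move=> f0 d20 lip Hf; apply/is_derive_Reals => eps eps0.
have ad2 : 0 < Rabs d2 by apply: Rabs_pos_lt.
pose L := Rmax 1 l; have L0 : 0 < L by have := Rmax_l 1 l; rewrite -/L; lra.
(* An error e on f over the box of size L |h| gives an error e L / |d2| on the
   quotient, so this choice leaves eps / 2. *)
have e0 : 0 < eps * Rabs d2 / L / 2.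
  apply: Rdiv_lt_0_compat; last lra.
  by apply: Rdiv_lt_0_compat => //; apply: Rmult_lt_0_compat.
have [dl Hdl] := Hf (mkposreal _ e0).
have dlL : 0 < dl / L by apply: Rdiv_lt_0_compat => //; exact: cond_pos.
have [r1 Hr1] := f0; have [r2 Hr2] := lip.
have r0 : 0 < Rmin (dl / L) (Rmin r1 r2) by repeat apply: Rmin_pos => //; exact: cond_pos.
exists (mkposreal _ r0) => h h0 /= hr.
have hE : x + h - x = h by ring.
have h1 : Rabs h < dl / L by apply: Rlt_le_trans hr _; exact: Rmin_l.
have h23 : Rabs h < Rmin r1 r2 by apply: Rlt_le_trans hr _; exact: Rmin_r.
have f1 : f (x + h) (y (x + h)) = 0.
  apply: Hr1; rewrite /ball /= /AbsRing_ball /abs /minus /plus /opp /=.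
  have -> : x + h + - x = h by ring.
  by apply: Rlt_le_trans h23 _; exact: Rmin_l.
have f2 : f x (y x) = 0.
  by apply: Hr1; exact: ball_center.
have := Hr2 (x + h); rewrite /ball /= /AbsRing_ball /abs /minus /plus /opp /= hE.
have -> : x + h + - x = h by ring.
move=> /(_ (Rlt_le_trans _ _ _ h23 (Rmin_r _ _))) Hl.
have ah : 0 < Rabs h by apply: Rabs_pos_lt.
have HL : Rabs (y (x + h) - y x) <= L * Rabs h.
  apply: Rle_trans Hl _; apply: Rmult_le_compat_r; first lra; exact: Rmax_r.
have hL : Rabs h <= L * Rabs h by have := Rmax_l 1 l; rewrite -/L; nra.
have LhD : L * Rabs h < dl.
  move: h1 => /(Rmult_lt_compat_l L _ _ L0).
  by replace (L * (dl / L)) with (pos dl) by (field; lra).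
have := Hdl (x + h) (y (x + h)); rewrite hE f1 f2 => /(_ ltac:(lra) ltac:(lra)) /=.
move=> Hd.
have Hd' : Rabs (d1 * h + d2 * (y (x + h) - y x)) <= eps * Rabs d2 / 2 * Rabs h.
  replace (eps * Rabs d2 / 2 * Rabs h) with (eps * Rabs d2 / L / 2 * (L * Rabs h))
    by (field; lra).
  rewrite -Rabs_Ropp.
  replace (- (d1 * h + d2 * (y (x + h) - y x))) with
    (0 - 0 - (d1 * h + d2 * (y (x + h) - y x))) by ring.
  apply: Rle_trans Hd _; apply: Rmult_le_compat_l; first lra.
  exact: Rmax_lub.
have -> : (y (x + h) - y x) / h - - d1 / d2 =
    (d1 * h + d2 * (y (x + h) - y x)) / (d2 * h) by field.
rewrite Rabs_div; last by apply: Rmult_integral_contrapositive.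
apply: (Rle_lt_trans _ (eps / 2)); last lra.
rewrite Rabs_mult; apply/Rle_div_l; first by apply: Rmult_lt_0_compat.
by apply: Rle_trans Hd' _; right; field.
Qed.

End ImplicitFunction.

From mathcomp Require Import ring.

(** * Derivatives of finite sums and products *)

Lemma is_derive_extr (g h : R -> R) (x dg : R) :
  g =1 h -> is_derive g x dg -> is_derive h x dg.
Proof. by move=> gh; apply: is_derive_ext. Qed.

Lemma is_derive_addr (g h : R -> R) (x dg dh : R) :
  is_derive g x dg -> is_derive h x dh -> is_derive (fun t => g t + h t) x (dg + dh).
Proof. exact: is_derive_plus. Qed.

Lemma is_derive_mulr (g h : R -> R) (x dg dh : R) :
  is_derive g x dg -> is_derive h x dh ->
  is_derive (fun t => g t * h t) x (dg * h x + g x * dh).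
Proof.
move=> Hg Hh; apply: is_derive_mult => // u v.
by rewrite /mult /=; exact: Rmult_comm.
Qed.

Lemma is_derive_cstr (c x : R) : is_derive (fun=> c) x 0.
Proof. exact: is_derive_const. Qed.

Lemma is_derive_divr (g h : R -> R) (x dg dh : R) :
  is_derive g x dg -> is_derive h x dh -> h x != 0 ->
  is_derive (fun t => g t / h t) x (dg / h x - g x * dh / h x ^+ 2).
Proof.
move=> Hg Hh h0; have := is_derive_div _ _ _ _ _ Hg Hh.
rewrite !(RdivE, RpowE, RmultE, RminusE) => H.
have -> : dg / h x - g x * dh / h x ^+ 2 = (dg * h x - g x * dh) / h x ^+ 2.
  by field.
by apply: H; apply/eqP.
Qed.

Lemma is_derive_sumr (I : eqType) (s : seq I) (g : I -> R -> R) (x : R) (dg : I -> R) :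
  (forall i, i \in s -> is_derive (g i) x (dg i)) ->
  is_derive (fun t => \sum_(i <- s) g i t) x (\sum_(i <- s) dg i).
Proof.
elim: s => [_|i s IH H].
  apply: (@is_derive_extr (fun=> 0)) => [t|]; rewrite big_nil //; exact: is_derive_cstr.
apply: (@is_derive_extr (fun t => g i t + \sum_(j <- s) g j t)) => [t|].
  by rewrite big_cons.
rewrite big_cons; apply: is_derive_addr; first by apply: H; rewrite mem_head.
by apply: IH => j js; apply: H; rewrite in_cons js orbT.
Qed.

Lemma is_derive_prodr (I : choiceType) (s : {fset I}) (g : I -> R -> R) (x : R)
    (dg : I -> R) :
  (forall i, i \in s -> is_derive (g i) x (dg i)) ->
  is_derive (fun t => \prod_(i <- s) g i t) x
    (\sum_(i <- s) dg i * \prod_(j <- (s `\ i)%fset) g j x).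
Proof.
elim/finSet_rect: s => s0 IHs0 H0; have [s0E|[i is0]] := fset_0Vmem s0.
  rewrite s0E; apply: (@is_derive_extr (fun=> 1)) => [t|]; rewrite big_seq_fset0 //.
  exact: is_derive_cstr.
have := IHs0 _ (fproperD1 is0); move: H0; rewrite -{1 6 7 8}(fsetD1K is0).
have : i \notin (s0 `\ i)%fset by rewrite !inE eqxx.
move: (s0 `\ i)%fset => s si H IH {IHs0 is0}.
have sU j : j \in s -> j \in (i |` s)%fset by move=> js; rewrite in_fset1U js orbT.
apply: (@is_derive_extr (fun t => g i t * \prod_(j <- s) g j t)) => [t|].
  by rewrite big_fsetU1.
rewrite big_fsetU1 //= fsetU1K //.
have -> : \sum_(k <- s) dg k * \prod_(j <- ((i |` s) `\ k)%fset) g j x =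
    g i x * \sum_(k <- s) dg k * \prod_(j <- (s `\ k)%fset) g j x.
  rewrite mulr_sumr !big_seq; apply: eq_bigr => k ks.
  have ik : i != k by apply: contraNneq si => ->.
  have -> : ((i |` s) `\ k = i |` (s `\ k))%fset.
    by apply/fsetP => j; rewrite !inE; case: (eqVneq j i) => [->|]; rewrite ?ik.
  have isk : i \notin (s `\ k)%fset by rewrite !inE negb_and si orbT.
  by rewrite big_fsetU1 //= mulrCA.
apply: is_derive_mulr; first by apply: H; rewrite fset1U1.
by apply: IH => j /sU; exact: H.
Qed.

(** Dividing the power by [j!] makes its derivative the divided power of index
    [j - 1], with no integer factor. *)
Lemma is_derive_exprr (g : R -> R) (x dg : R) (j : nat) :
  is_derive g x dg ->
  is_derive (fun t => g t ^+ j / j`!%:R) x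
    (if (0 < j)%N then g x ^+ j.-1 / j.-1`!%:R * dg else 0).
Proof.
move=> Hg; apply: (@is_derive_extr (fun t => (pow (g t) j) * j`!%:R^-1)) => [t|].
  by rewrite RpowE.
have -> : (if (0 < j)%N then g x ^+ j.-1 / j.-1`!%:R * dg else 0) =
    Rmult (Rmult (INR j) dg) (pow (g x) j.-1) * j`!%:R^-1 + pow (g x) j * 0.
  rewrite mulr0 addr0 INRE !(RpowE, RmultE).
  case: j => [|j] /=; first by rewrite !mul0r.
  rewrite factS natrM invfM.
  have : j.+1%:R != 0 :> R by rewrite pnatr_eq0.
  have : j`!%:R != 0 :> R by rewrite pnatr_eq0 -lt0n fact_gt0.
  by move: (j.+1%:R) (j`!%:R) (g x ^+ j) => u v w v0 u0; field; rewrite u0 v0.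
exact: is_derive_mulr (is_derive_pow _ j _ _ Hg) (is_derive_cstr _ x).
Qed.

(** * Adding one element to a finite multiset *)

(** With [big_finsuppD1], this compares a product over the support of [k] to the
    product over the support of [p +` k]: both share the factors of index
    different from [p]. *)
Lemma big_finsupp_mset1D (V : Type) (idx : V) (op : Monoid.com_law idx) (T : choiceType)
    (F : T -> nat -> V) (p : T) (k : {mset T}) :
    (forall q, F q 0%N = idx) ->
  \big[op/idx]_(q <- finsupp (p +` k)) F q ((p +` k) q) =
    op (F p (k p).+1) (\big[op/idx]_(q <- (finsupp k `\ p)%fset) F q (k q)).
Proof.
move=> F0; rewrite (big_fsetD1 p) /=; last by rewrite msuppE mset1D1.
rewrite mset1DE eqxx; congr (op _ _).
rewrite -(big_fset_incl _ (A := (finsupp k `\ p)%fset)).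
- apply: eq_big_seq => q; rewrite in_fsetD1 => /andP[/negPf qp _].
  by rewrite mset1DE qp.
- apply/fsubsetP => q; rewrite !in_fsetD1 => /andP[-> /=].
  by rewrite !msuppE in_mset1D orbC => ->.
- move=> q; rewrite !in_fsetD1 => /andP[qp _]; rewrite qp /= msuppE => /mset_eq0P kq.
  by rewrite mset1DE (negPf qp) kq.
Qed.

Lemma big_finsuppD1 (V : Type) (idx : V) (op : Monoid.com_law idx) (T : choiceType)
    (F : T -> nat -> V) (p : T) (k : {mset T}) :
    (forall q, F q 0%N = idx) ->
  \big[op/idx]_(q <- finsupp k) F q (k q) =
    op (F p (k p)) (\big[op/idx]_(q <- (finsupp k `\ p)%fset) F q (k q)).
Proof.
move=> F0; have [pk|pk] := boolP (p \in finsupp k); first by rewrite (big_fsetD1 p).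
rewrite mem_fsetD1 //; move: pk; rewrite msuppE => /mset_eq0P ->.
by rewrite F0 Monoid.mul1m.
Qed.

(** Such multisets are images of tuples of bounded length over a finite type. *)
Lemma finite_mset_box (T : choiceType) (t : seq T) (N : nat) :
  finite_set [set m : {mset T} | {subset m <= t} /\ (size m <= N)%N].
Proof.
pose h (u : {j : 'I_N.+1 & j.-tuple (seq_sub t)}) : {mset T} :=
  seq_mset [seq val v | v <- tagged u].
apply: (@sub_finite_set _ _ (range h)); last exact/finite_image/finite_finset.
move=> m /= [mt mN].
have [w wE] : exists w : seq (seq_sub t), [seq val v | v <- w] = m.
  have {mt}: all (mem t) (m : seq T) by apply/allP => x /mt.
  elim: (enum_mset m) => [_|c s IH /= /andP[ct /IH[w <-]]]; first by exists [::].
  by exists (SeqSub ct :: w).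
have sw : (size w < N.+1)%N by rewrite ltnS -(size_map val) wE.
exists (Tagged (fun j : 'I_N.+1 => j.-tuple (seq_sub t))
  (in_tuple w : (Ordinal sw).-tuple _)) => //.
by rewrite /h /= wE seq_mset_id.
Qed.

(** * The families of [An n] *)

Definition weight (c : nat * nat -> nat) (m : {mset nat * nat}) : nat :=
  (\sum_(p <- finsupp m) c p * m p)%N.

Lemma weight_mset1D c p (k : {mset nat * nat}) : weight c (p +` k) = (c p + weight c k)%N.
Proof.
have F0 q : (c q * 0 = 0)%N by rewrite muln0.
rewrite /weight (big_finsupp_mset1D _ (F := fun q j => c q * j)%N) //.
by rewrite (big_finsuppD1 _ (F := fun q j => c q * j)%N p k) //= mulnS addnA.
Qed.

Lemma size_mset1D p (k : {mset nat * nat}) : size (p +` k) = (size k).+1.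
Proof.
rewrite !size_mset (big_finsupp_mset1D _ (F := fun _ j => j)) //=.
by rewrite (big_finsuppD1 _ (F := fun _ j => j) p k) //= addSn.
Qed.

(** The second equation of [An n] is put in a form without subtraction:
    [R(m) - |m| = -1]. *)
Lemma AnP n (m : {mset nat * nat}) : An n m <->
  [/\ forall p, p \in finsupp m -> (2 <= p.1 + p.2)%N,
      weight fst m = n & size m = (weight snd m).+1].
Proof.
rewrite /An /= -/(weight fst m).
have -> : \sum_(p <- finsupp m) (p.2%:Z - 1) * (m p)%:Z =
          (weight snd m)%:Z - (size m)%:Z.
  rewrite size_mset /weight !(big_morph _ PoszD (erefl _)) -sumrB.
  by apply: eq_bigr => p _; rewrite mulrBl mul1r PoszM.
split=> -[H1 H2 H3]; split=> //; move: H3; move: (weight _ _) (size _) => u v.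
  by move=> /eqP; rewrite subr_eq => /eqP; lia.
by move=> ->; rewrite -addn1 PoszD; ring.
Qed.

(** The conditions on [p +` k] see [p] only through its coordinates, so [p] can be
    relabelled while [k] stays fixed. *)
Lemma An_mset1D n p (k : {mset nat * nat}) : An n (p +` k) <->
  [/\ (2 <= p.1 + p.2)%N, forall q, q \in finsupp k -> (2 <= q.1 + q.2)%N,
      (p.1 + weight fst k = n)%N & (p.2 + weight snd k = size k)%N].
Proof.
rewrite AnP !weight_mset1D size_mset1D; split=> [[H Hl Hr]|[Hp Hk Hl Hr]].
  split=> //; last by case: Hr.
  - by apply: H; rewrite msuppE mset1D1.
  - by move=> q; rewrite msuppE => qk; apply: H; rewrite msuppE mset1Dr.
split=> //; last by rewrite Hr.
by move=> q; rewrite !msuppE in_mset1D -msuppE => /orP[/eqP ->|/Hk].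
Qed.

(** Every member of the family has order at least 2; this bounds the size and
    the members of the families of [An n]. *)
Lemma two_size_le (k : {mset nat * nat}) :
    (forall q, q \in finsupp k -> (2 <= q.1 + q.2)%N) ->
  (2 * size k <= weight fst k + weight snd k)%N.
Proof.
move=> H; rewrite size_mset /weight -big_split big_distrr /=.
rewrite !big_seq; apply: leq_sum => q qk.
by rewrite -mulnDl leq_mul2r H // orbT.
Qed.

Lemma An_bound n (m : {mset nat * nat}) p :
  An n m -> p \in finsupp m -> (p.1 + p.2 <= n)%N.
Proof.
move=> Am; rewrite msuppE => pm; move: Am.
rewrite -(msetB1K pm) => /An_mset1D[_ /two_size_le]; lia.
Qed.

Lemma An_size n (m : {mset nat * nat}) : An n m -> (size m <= n)%N.
Proof. by move=> /AnP[/two_size_le]; lia. Qed.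

Lemma finite_An n : finite_set (An n).
Proof.
pose t := [seq (i, j) | i <- iota 0 n.+1, j <- iota 0 n.+1].
apply: sub_finite_set (finite_mset_box t n) => m Am; split; last exact: An_size Am.
move=> [l r]; rewrite -msuppE => /(An_bound Am) /= lr.
by apply/allpairs_f; rewrite mem_iota; lia.
Qed.

(** Removing a member [p] of [m] leaves a family [k] with a hole labelled [p], and
    [m] is recovered as [p +` k].  In this form a sum can be reindexed by
    changing the label of the hole. *)
Lemma sum_holes (K : zmodType) (B : set {mset nat * nat})
    (G : {mset nat * nat} -> nat * nat -> K) : finite_set B ->
  \sum_(m \in B) \sum_(p <- finsupp m) G (m `\ p) p =
  \sum_(kp \in [set kp | B (kp.2 +` kp.1)]) G kp.1 kp.2.
Proof.
move=> finB; rewrite fsbig_finite //.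
pose holes := [seq (m `\ p, p) | m : {mset nat * nat} <- fset_set B, p <- finsupp m].
have -> : [set kp | B (kp.2 +` kp.1)] = [set` holes].
  apply/seteqP; split=> -[k p] /=.
    move=> Bkp; apply/allpairsPdep; exists (p +` k), p; split=> //.
    - by rewrite in_fset_set // inE.
    - by rewrite msuppE mset1D1.
    - by rewrite msetD1K.
  case/allpairsPdep=> m [q []]; rewrite in_fset_set // inE msuppE => Bm qm [-> ->].
  by rewrite msetB1K.
rewrite -fsbig_seq; first by rewrite /holes big_allpairs_dep.
apply: allpairs_uniq_dep => [|m _|]; [exact: fset_uniq|exact: fset_uniq|].
move=> _ _ /allpairsPdep[m [p [_ + ->]]] /allpairsPdep[m' [p' [_ + ->]]] /=.
rewrite !msuppE => pm pm' [eqm eqp].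
by move: pm' (msetB1K pm'); rewrite -eqm -eqp msetB1K // => _ <-.
Qed.

(** * Divided-power monomials and the Leibniz rule *)

Section DividedMonomials.
Variable K : numFieldType.
Implicit Types (a c : nat * nat -> K) (m k : {mset nat * nat}).

(** Divided-power monomials absorb the multinomial denominators, so that neither
    the Leibniz rule nor the insertion of a factor creates multiplicities beyond
    the one in [dpmono_mset1D]. *)
Definition dpmono a m : K := \prod_(p <- finsupp m) (a p ^+ m p / (m p)`!%:R).

Lemma dpmono_mset1D a p k :
  (k p).+1%:R * dpmono a (p +` k) = dpmono a k * a p.
Proof.
have F0 q : a q ^+ 0 / 0`!%:R = 1 by rewrite expr0 fact0 divr1.
rewrite /dpmono (big_finsupp_mset1D _ (F := fun q j => a q ^+ j / j`!%:R)) //.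
rewrite (big_finsuppD1 _ (F := fun q j => a q ^+ j / j`!%:R) p k) //=.
rewrite mulrA [RHS]mulrAC; congr (_ * _); rewrite factS natrM exprS.
have : (k p).+1%:R != 0 :> K by rewrite pnatr_eq0.
have : (k p)`!%:R != 0 :> K by rewrite pnatr_eq0 -lt0n fact_gt0.
move: (k p).+1%:R (k p)`!%:R (a p) => u v x v0 u0.
by move: (x ^+ _) => w; field; rewrite u0 v0.
Qed.

(** Euler's identity for the grading that gives [a p] degree [c p]. *)
Lemma sum_dpmonoB1 a (c : nat * nat -> nat) m :
  \sum_(p <- finsupp m) dpmono a (m `\ p) * ((c p)%:R * a p) =
  (weight c m)%:R * dpmono a m.
Proof.
rewrite /weight natr_sum mulr_suml !big_seq; apply: eq_bigr => p.
rewrite msuppE => pm; rewrite mulrCA -dpmono_mset1D msetB1K // mulrA natrM.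
by rewrite -{3}(msetB1K pm) mset1DE eqxx.
Qed.

Definition lagrange_coef m : K := (-1) ^+ size m * (weight snd m)`!%:R.

Definition lagrange_sum a n : K :=
  \sum_(m \in An n) lagrange_coef m * dpmono a m.

(** The value at [lagrange_sum a n] of the derivation sending [a p] to [c p]. *)
Definition leibniz_sum a n c : K :=
  \sum_(m \in An n) lagrange_coef m *
    \sum_(p <- finsupp m) dpmono a (m `\ p) * c p.

Lemma leibniz_sumD a n c d :
  leibniz_sum a n (fun p => c p + d p) = leibniz_sum a n c + leibniz_sum a n d.
Proof.
rewrite /leibniz_sum -fsbig_split; last exact: finite_An.
apply: eq_fsbigr => m _; under eq_bigr do rewrite mulrDr.
by rewrite big_split mulrDr.
Qed.

Lemma leibniz_sumZ a n x c :
  leibniz_sum a n (fun p => x * c p) = x * leibniz_sum a n c.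
Proof.
rewrite /leibniz_sum mulr_fsumr; apply: eq_fsbigr => m _.
under eq_bigr do rewrite mulrCA.
by rewrite -mulr_sumr mulrCA.
Qed.

Lemma eq_leibniz_sum a n c d :
    (forall p, (2 <= p.1 + p.2)%N -> c p = d p) ->
  leibniz_sum a n c = leibniz_sum a n d.
Proof.
move=> cd; apply: eq_fsbigr => m; rewrite inE => /AnP[m2 _ _].
by congr (_ * _); rewrite !big_seq; apply: eq_bigr => p /m2 /cd ->.
Qed.

Lemma leibniz_sum_holes a n c : leibniz_sum a n c =
  \sum_(kp \in [set kp | An n (kp.2 +` kp.1)])
    lagrange_coef (kp.2 +` kp.1) * (dpmono a kp.1 * c kp.2).
Proof.
rewrite -(sum_holes (fun k p => lagrange_coef (p +` k) * (dpmono a k * c p))).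
  apply: eq_fsbigr => m _; rewrite mulr_sumr !big_seq; apply: eq_bigr => p.
  by rewrite msuppE => pm; rewrite msetB1K.
exact: finite_An.
Qed.

Lemma leibniz_sum_weight a n (c : nat * nat -> nat) :
  leibniz_sum a n (fun p => (c p)%:R * a p) =
  \sum_(m \in An n) (weight c m)%:R * (lagrange_coef m * dpmono a m).
Proof. by apply: eq_fsbigr => m _; rewrite sum_dpmonoB1 mulrCA. Qed.

Lemma leibniz_sum_pred1 a n q :
  leibniz_sum a n (fun p => (p == q)%:R) =
  \sum_(k \in [set k | An n (q +` k)]) lagrange_coef (q +` k) * dpmono a k.
Proof.
rewrite leibniz_sum_holes.
transitivity (\sum_(kp \in [set kp | An n (kp.2 +` kp.1)])
    if kp \in [set kp | kp.2 = q] then lagrange_coef (q +` kp.1) * dpmono a kp.1 else 0).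
  apply: eq_fsbigr => -[k p] _ /=.
  have [->|pq] := eqVneq p q; first by rewrite mulr1 ifT // inE.
  by rewrite !mulr0 ifF //; apply/negP; rewrite inE /=; apply/eqP.
rewrite -fsbig_mkcondr.
rewrite (reindex_fsbig (fun k => (k, q)) [set k | An n (q +` k)]) //.
split=> [k /=|k k' _ _ []|[k p] /= [Ak pq]] //.
by exists k; rewrite -pq.
Qed.

End DividedMonomials.

(** The Leibniz rule in divided-power form: each term removes one copy of [p]
    from the family, with coefficient 1. *)
Lemma is_derive_dpmono (a : R -> nat * nat -> R) (x : R) (b : nat * nat -> R)
    (m : {mset nat * nat}) :
  (forall p, p \in finsupp m -> is_derive (a^~ p) x (b p)) ->
  is_derive (fun t => dpmono (a t) m) x
    (\sum_(p <- finsupp m) dpmono (a x) (m `\ p) * b p).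
Proof.
move=> Ha; have -> : \sum_(p <- finsupp m) dpmono (a x) (m `\ p) * b p =
  \sum_(p <- finsupp m)
    (if (0 < m p)%N then a x p ^+ (m p).-1 / (m p).-1`!%:R * b p else 0) *
    \prod_(q <- (finsupp m `\ p)%fset) (a x q ^+ m q / (m q)`!%:R).
  rewrite !big_seq; apply: eq_bigr => p; rewrite msuppE => pm.
  have F0 q : a x q ^+ 0 / 0`!%:R = 1 by rewrite expr0 fact0 divr1.
  rewrite mset_gt0 pm mulrAC /dpmono; congr (_ * _).
  rewrite (big_finsuppD1 _ (F := fun q j => a x q ^+ j / j`!%:R) p (m `\ p)) //=.
  rewrite msetB1E eqxx subn1; congr (_ * _).
  rewrite (_ : (finsupp (m `\ p)%mset `\ p = finsupp m `\ p)%fset).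
    rewrite !big_seq; apply: eq_bigr => q; rewrite in_fsetD1 => /andP[/negPf qp _].
    by rewrite msetB1E qp subn0.
  apply/fsetP => q; rewrite !in_fsetD1 !msuppE in_msetB1.
  by case: eqP => //= _; rewrite implybF.
apply: is_derive_prodr => p pm; apply: is_derive_exprr; exact: Ha.
Qed.

(** * The derivation that raises the order *)

Lemma mem_setb (T : choiceType) (b : T -> bool) x : (x \in [set y | b y]) = b x.
Proof. by apply/idP/idP; rewrite inE. Qed.

Section DerivationIdentity.
Variables (K : numFieldType) (a : nat * nat -> K).
Implicit Types (m k : {mset nat * nat}).

Lemma lagrange_coef_mset1D p k : lagrange_coef K (p +` k) =
  (-1) ^+ (size k).+1 * (p.2 + weight snd k)`!%:R.
Proof. by rewrite /lagrange_coef size_mset1D weight_mset1D. Qed.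

Lemma weight_cst1 m : weight (fun=> 1%N) m = size m.
Proof. by rewrite /weight size_mset; apply: eq_bigr => p _; rewrite mul1n. Qed.

(** Relabelling a hole [(l, r)] as [(l.+1, r)] goes from [An n] to [An n.+1] and
    keeps the coefficient; it reaches every label with [l > 0] except those of
    order 2. *)
Lemma leibniz_sum_shift n :
  leibniz_sum a n (fun p => p.1.+1%:R * a (p.1.+1, p.2)) =
  leibniz_sum a n.+1
    (fun p => if (0 < p.1)%N && (3 <= p.1 + p.2)%N then p.1%:R * a p else 0).
Proof.
rewrite !leibniz_sum_holes.
transitivity (\sum_(kp \in [set kp | An n.+1 (kp.2 +` kp.1)])
    if kp \in [set kp | (0 < kp.2.1)%N && (3 <= kp.2.1 + kp.2.2)%N]
    then lagrange_coef K (kp.2 +` kp.1) * (dpmono a kp.1 * (kp.2.1%:R * a kp.2))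
    else 0); last first.
  apply: eq_fsbigr => -[k p] _ /=; rewrite mem_setb /=.
  by case: ifP; rewrite ?mulr0.
rewrite -fsbig_mkcondr.
set P := [set kp | An n _].
rewrite [RHS](reindex_fsbig (fun kp => (kp.1, (kp.2.1.+1, kp.2.2))) P).
  by apply: eq_fsbigr => -[k [l r]] _ /=; rewrite !lagrange_coef_mset1D.
split=> [[k [l r]]|[k [l r]] [k' [l' r']] _ _ /= [-> -> ->]|[k [[|l] r]]] //=.
  rewrite /P /= => /An_mset1D[/= p2 k2 Hl Hr].
  by split=> //; apply/An_mset1D; split=> //=; rewrite addSn ?Hl // ltnW.
  by case.
case=> /An_mset1D[/= p2 k2 Hl Hr] p3; exists (k, (l, r)) => //.
by apply/An_mset1D; split=> //; move: Hl; rewrite addSn => -[].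
Qed.

(** A member [(1, 1)] of a family of [An n.+1] can be removed freely: what is left
    is an arbitrary element [k] of [An n], and [R(k) + 1 = |k|] turns the
    coefficient of the larger family into [- |k|] times that of [k]. *)
Lemma leibniz_sum_pred1_11 n :
  leibniz_sum a n.+1 (fun p => (p == (1, 1)%N)%:R) = - leibniz_sum a n a.
Proof.
have -> : leibniz_sum a n a = leibniz_sum a n (fun p => 1%:R * a p).
  by apply: eq_leibniz_sum => p _; rewrite mul1r.
rewrite (leibniz_sum_weight a n (fun=> 1%N)) leibniz_sum_pred1 -mulN1r mulr_fsumr.
rewrite (_ : [set k | _] = An n); last first.
  apply/seteqP; split=> k /=; rewrite An_mset1D AnP /=.
    by move=> [_ k2 [<-] <-].
  by move=> [k2 <- ->].
apply: eq_fsbigr => k; rewrite inE => /AnP[_ _ Hr].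
rewrite lagrange_coef_mset1D weight_cst1 /lagrange_coef Hr exprS factS natrM.
by move: (_ ^+ _) (_.+1%:R) (_`!%:R) (dpmono a k) => e u v w; ring.
Qed.

(** Removing a member [(2, 0)] from a family of [An n.+1] leaves [m] with
    [R(m) = |m| > 0].  Since [R(m)! = (R(m) - 1)! * sum_p r_p m_p], its term can be
    distributed over the members of [m]; relabelling each as
    [(l.+1, r.-1)] gives the holes of the families of [An n]. *)
Lemma leibniz_sum_slope n : (2 <= n)%N ->
  leibniz_sum a n
    (fun p => if (0 < p.1)%N then p.2.+1%:R * a (p.1.-1, p.2.+1) else 0) =
  - leibniz_sum a n.+1 (fun p => (p == (2, 0)%N)%:R).
Proof.
move=> n2; rewrite leibniz_sum_pred1 leibniz_sum_holes.
(* Lowering l and raising r by one turns a hole of An n into a hole of S; the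
   factor r of the new label lets the condition r > 0 be dropped afterwards. *)
set S := [set k | An n.+1 _].
have finS : finite_set S.
  apply: sub_finite_set (finite_image (fun m => m `\ (2, 0)%N) (finite_An n.+1)).
  by move=> k Sk; exists ((2, 0)%N +` k) => //; rewrite msetD1K.
transitivity (\sum_(kp \in [set kp | An n (kp.2 +` kp.1)])
    if kp \in [set kp | (0 < kp.2.1)%N]
    then lagrange_coef K (kp.2 +` kp.1) *
      (dpmono a kp.1 * (kp.2.2.+1%:R * a (kp.2.1.-1, kp.2.2.+1)))
    else 0).
  apply: eq_fsbigr => -[k p] _ /=; rewrite mem_setb /=.
  by case: ifP; rewrite ?mulr0.
rewrite -fsbig_mkcondr.
set P := setI [set kp | S (kp.2 +` kp.1)] [set kp | (0 < kp.2.2)%N].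
pose g m p : K := (-1) ^+ (size m) * (weight snd m).-1`!%:R *
  (dpmono a (m `\ p) * (p.2%:R * a p)).
transitivity (\sum_(kp \in P) g (kp.2 +` kp.1) kp.2).
  rewrite [RHS](reindex_fsbig (fun kp => (kp.1, (kp.2.1.-1, kp.2.2.+1)))
    (setI [set kp | An n (kp.2 +` kp.1)] [set kp | (0 < kp.2.1)%N])).
    apply: eq_fsbigr => -[k [l r]] _ /=.
    by rewrite /g /= msetD1K lagrange_coef_mset1D size_mset1D weight_mset1D.
  split=> [[k [[|l] r]]|[k [[|l] r]] [k' [[|l'] r']]|[k [l [|r]]]] //=.
  - by rewrite /P/S/= => -[].
  - rewrite /P /S /= => -[/An_mset1D[/= p2 k2 Hl Hr] _]; split=> //.
    apply/An_mset1D; split=> //=.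
    + move=> q; rewrite msuppE in_mset1D => /orP[/eqP -> /=|].
        by rewrite addnS -addSn.
      by rewrite -msuppE; exact: k2.
    + by rewrite weight_mset1D /= -Hl addnA.
    + by rewrite weight_mset1D size_mset1D /= -Hr.
  - by rewrite !inE => -[].
  - by rewrite !inE => -[].
  - by rewrite !inE => _ [].
  - by move=> _ _ [-> -> ->].
  - by rewrite /P/= => -[].
  - rewrite /P /S /= => -[/An_mset1D[/= p2 k2]].
    rewrite !weight_mset1D size_mset1D => Hl Hr _; exists (k, (l.+1, r)) => //=.
    split=> //; apply/An_mset1D; split=> //=.
    + have := k2 (l, r.+1); rewrite /= addnS -addSn; apply.
      by rewrite msuppE mset1D1.
    + by move=> q; rewrite msuppE => qk; apply: k2; rewrite msuppE mset1Dr.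
    + by move: Hl => /=; lia.
    + by move: Hr => /=; lia.
transitivity (\sum_(kp \in [set kp | S (kp.2 +` kp.1)]) g (kp.2 +` kp.1) kp.2).
  rewrite /P fsbig_mkcondr; apply: eq_fsbigr => -[k [l [|r]]] _ /=.
    by rewrite mem_setb /= /g !mul0r !mulr0.
  by rewrite mem_setb.
rewrite -(sum_holes (fun k p => g (p +` k) p)) // -mulN1r mulr_fsumr.
apply: eq_fsbigr => m; rewrite inE /S /= => /An_mset1D[/= _ k2 Hl Hr].
transitivity (\sum_(p <- finsupp m) g m p).
  by rewrite !big_seq; apply: eq_bigr => p; rewrite msuppE => pm; rewrite msetB1K.
rewrite /g -mulr_sumr (sum_dpmonoB1 a snd) lagrange_coef_mset1D /= add0n exprS.
(* Otherwise m would be empty, that is n + 1 = 2. *)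
have m0 : (0 < weight snd m)%N.
  rewrite lt0n; apply/negP => /eqP m0; move: Hl Hr; rewrite m0 => + /esym /eqP.
  rewrite size_mset_eq0 => + /eqP mE; rewrite mE /weight finsupp0 big_seq_fset0; lia.
rewrite -(prednK m0) /= factS natrM.
by move: (_ ^+ _) (_.+1%:R) (_`!%:R) (dpmono a m) => e u v w; ring.
Qed.

(** How the normalised coefficients [a p] vary along the curve, see
    [is_derive_taylor_coef]. *)
Definition coef_derivation (p : nat * nat) : K :=
  p.1.+1%:R * a (p.1.+1, p.2)
  - (a (2, 0)%N *+ 2 *
       (if (0 < p.1)%N then p.2.+1%:R * a (p.1.-1, p.2.+1) else 0)
     + a (1, 1)%N * a p).

(** By Euler's identity the factor [n.+1] is the sum of the first coordinates of
    the members, so the right-hand side is a sum over holes of [An n.+1].  Its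
    holes of order at least 3 come from the first term of [coef_derivation],
    the holes [(2, 0)] from the second and [(1, 1)] from the third. *)
Lemma leibniz_sum_derivation n : (2 <= n)%N ->
  leibniz_sum a n coef_derivation = n.+1%:R * lagrange_sum a n.+1.
Proof.
move=> n2.
have -> : n.+1%:R * lagrange_sum a n.+1 = leibniz_sum a n.+1 (fun p => p.1%:R * a p).
  rewrite (leibniz_sum_weight a n.+1 fst) mulr_fsumr; apply: eq_fsbigr => m.
  by rewrite inE => /AnP[_ -> _].
transitivity (leibniz_sum a n.+1 (fun p =>
  (if (0 < p.1)%N && (3 <= p.1 + p.2)%N then p.1%:R * a p else 0)
  + (a (2, 0)%N *+ 2 * (p == (2, 0)%N)%:R + a (1, 1)%N * (p == (1, 1)%N)%:R))).
  have -> : leibniz_sum a n coef_derivation = leibniz_sum a n (fun p =>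
    p.1.+1%:R * a (p.1.+1, p.2) + (- (a (2, 0)%N *+ 2) *
       (if (0 < p.1)%N then p.2.+1%:R * a (p.1.-1, p.2.+1) else 0)
     + - a (1, 1)%N * a p)).
    by apply: eq_leibniz_sum => p _; rewrite /coef_derivation !mulNr opprD.
  rewrite !leibniz_sumD !leibniz_sumZ leibniz_sum_pred1_11.
  rewrite -leibniz_sum_shift -[leibniz_sum _ _ (fun p => (p == (2, 0)%N)%:R)]opprK.
  rewrite -leibniz_sum_slope //.
  ring.
apply: eq_leibniz_sum => -[[|[|[|l]]] [|[|r]]] //= _; rewrite ?xpair_eqE /=; ring.
Qed.

End DerivationIdentity.

Lemma An2 : An 2 = [set ((2, 0)%N +` mset0 : {mset nat * nat})].
Proof.
apply/seteqP; split=> [m /= Am|m /= ->]; last first.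
  by apply/An_mset1D; rewrite /weight finsupp0 !big_seq_fset0 size_mset0.
have [m0|[p pm]] := mset_0Vmem m.
  by move: Am => /AnP[_ _]; rewrite m0 size_mset0.
move: Am; rewrite -(msetB1K pm) => /An_mset1D[p2 k2 Hl Hr].
have := two_size_le k2; move: p2 k2 Hl Hr; move: (m `\ p) => k p2 k2 Hl Hr le_k.
have k0 : k = mset0 by apply/eqP; rewrite -size_mset_eq0; apply/eqP; lia.
move: Hl Hr; rewrite k0 /weight finsupp0 !big_seq_fset0 size_mset0 !addn0.
by case: p {pm p2 le_k} => l r /= -> ->.
Qed.

Lemma lagrange_sum2 (K : numFieldType) (a : nat * nat -> K) :
  lagrange_sum a 2 = - a (2, 0)%N.
Proof.
rewrite /lagrange_sum An2 fsbig_set1 lagrange_coef_mset1D.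
have := dpmono_mset1D a (2, 0)%N mset0; rewrite mset0E mul1r => ->.
by rewrite /dpmono /weight finsupp0 !big_seq_fset0 size_mset0 mulr1 mulN1r mul1r.
Qed.

(** * Derivatives along the curve *)

(** [P i j] stands for [d_x^i d_y^j f] along the curve and [q] for its slope; the
    only relation used between the [P i j] is the chain rule. *)
Section AlongCurve.
Variables (D : R -> Prop) (n : nat) (y : R -> R) (P : nat -> nat -> R -> R).
Let q x : R := (- P 1 0 x / P 0 1 x)%R.
Hypothesis n2 : (2 <= n)%N.
Hypothesis openD : forall x, D x -> locally x D.
Hypothesis P01_neq0 : forall x, D x -> P 0 1 x != 0.
Hypothesis is_derive_P : forall x i j, D x -> (i + j < n)%N ->
  is_derive (P i j) x (P i.+1 j x + q x * P i j.+1 x).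
Hypothesis is_derive_y : forall x, D x -> is_derive y x (q x).

(** [(d_x + q d_y)^l d_x^i d_y^j f], with [q] treated as a constant. *)
Fixpoint frozen_derivative (l i j : nat) (x : R) : R :=
  (if l is l'.+1 then
     frozen_derivative l' i.+1 j x + q x * frozen_derivative l' i j.+1 x
   else P i j x)%R.
Local Notation C := frozen_derivative.

Lemma is_derive_slope x : D x -> is_derive q x (- (C 2 0 0 x / P 0 1 x)).
Proof.
move=> Dx; have P0 := P01_neq0 Dx.
have H10 : is_derive (fun t => -1 * P 1 0 t) x _ :=
  is_derive_mulr (is_derive_cstr _ x) (@is_derive_P x 1 0 Dx n2).
have H := is_derive_divr H10 (@is_derive_P x 0 1 Dx n2) P0.
have -> : - (C 2 0 0 x / P 0 1 x) =
  (0 * P 1 0 x + -1 * (P 2 0 x + q x * P 1 1 x)) / P 0 1 x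
  - -1 * P 1 0 x * (P 1 1 x + q x * P 0 2 x) / P 0 1 x ^+ 2.
  by rewrite /= /q; field.
by apply: is_derive_extr H => t; rewrite mulN1r.
Qed.

(** If [q] were constant, the derivative would be [C l.+1 i j]; the correction
    comes from differentiating the [l] factors [d_x + q d_y]. *)
Lemma is_derive_frozen l i j x : D x -> (l + i + j < n)%N ->
  is_derive (C l i j) x
    (C l.+1 i j x - l%:R * (C 2 0 0 x / P 0 1 x) * C l.-1 i j.+1 x).
Proof.
move=> Dx; elim: l i j => [|l IH] i j lt_n.
  by rewrite !mul0r subr0; apply: is_derive_P.
have H1 := IH i.+1 j ltac:(lia); have H2 := IH i j.+1 ltac:(lia).
have := is_derive_addr H1 (is_derive_mulr (is_derive_slope Dx) H2).
move: (C 2 0 0 x / P 0 1 x) => s.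
set e := (X in is_derive _ _ X -> _) => H.
suff <- : e = C l.+2 i j x - l.+1%:R * s * C l i j.+1 x by [].
rewrite /e; case: l {IH lt_n H1 H2 H e} => [|l] /=; first by ring.
by rewrite -!natr1; ring.
Qed.

(** The Taylor coefficients of [f], in the coordinates where the tangent to the
    curve is the first axis, normalised so that the one of index [(0, 1)] is 1. *)
Definition taylor_coef x (p : nat * nat) : R :=
  (C p.1 0 p.2 x / (p.1`!%:R * p.2`!%:R * P 0 1 x))%R.

Lemma is_derive_taylor_coef x p : D x -> (p.1 + p.2 < n)%N ->
  is_derive (taylor_coef^~ p) x (coef_derivation (taylor_coef x) p).
Proof.
move=> Dx; case: p => l r /= lr_n; have P0 := P01_neq0 Dx.
have l0 : l`!%:R != 0 :> R by rewrite pnatr_eq0 -lt0n fact_gt0.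
have r0 : r`!%:R != 0 :> R by rewrite pnatr_eq0 -lt0n fact_gt0.
have H0 := is_derive_mulr (is_derive_cstr (l`!%:R * r`!%:R)%R x)
  (@is_derive_P x 0 1 Dx n2).
have lr0 : l`!%:R * r`!%:R * P 0 1 x != 0 by rewrite !mulf_neq0.
have Hl := @is_derive_frozen l 0 r x Dx ltac:(lia).
have := is_derive_divr Hl H0 lr0.
set e := (X in is_derive _ _ X -> _) => H.
suff <- : e = coef_derivation (taylor_coef x) (l, r) by [].
rewrite /e /coef_derivation /taylor_coef.
have -> : P 1 1 x + q x * P 0 2 x = C 1 0 1 x by [].
cbn [fst snd].
have lS : l.+1%:R != 0 :> R by rewrite pnatr_eq0.
have rS : r.+1%:R != 0 :> R by rewrite pnatr_eq0.
have [f2 f1 f0] : [/\ 2`!%:R = 2 :> R, 1`!%:R = 1 :> R & 0`!%:R = 1 :> R] by [].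
rewrite ?f2 ?f1 ?f0 factS natrM (factS r) natrM.
case: l l0 lS {lr_n H0 lr0 Hl e H} => [|l].
  rewrite ltnn ?f0 => _ _.
  move: (C 1 0 r x) (C 1 0 1 x) (C 0 0 r x) (C 2 0 0 x) (C 0.-1 0 r.+1 x).
  move=> c1 c2 c3 c4 c5.
  by move: (r`!%:R) (P 0 1 x) r0 P0 => w z w0 z0; field; rewrite w0 z0.
rewrite ltn0Sn [l.+1.-1]/=.
rewrite factS natrM mulf_eq0 negb_or => /andP[].
move: (l.+2%:R) (l.+1%:R) (l`!%:R) (r.+1%:R) (r`!%:R) r0 rS => a1 a2 a3 b1 b2.
move=> b2n b1n a2n a3n a1n.
move: (C l.+2 0 r x) (C 2 0 0 x) (C l 0 r.+1 x) (C l.+1 0 r x) (C 1 0 1 x).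
by move=> c1 c2 c3 c4 c5; field; rewrite P0 b2n b1n a2n a3n a1n.
Qed.

Lemma is_derive_lagrange_sum x k : D x -> (2 <= k < n)%N ->
  is_derive (fun t => lagrange_sum (taylor_coef t) k) x
    (k.+1%:R * lagrange_sum (taylor_coef x) k.+1).
Proof.
move=> Dx /andP[k2 kn]; rewrite -leibniz_sum_derivation // /lagrange_sum /leibniz_sum.
rewrite fsbig_finite; last exact: finite_An.
apply: (@is_derive_extr (fun t =>
  \sum_(m <- fset_set (An k)) lagrange_coef R m * dpmono (taylor_coef t) m)).
  by move=> t; rewrite fsbig_finite //; exact: finite_An.
apply: is_derive_sumr => m; rewrite in_fset_set; last exact: finite_An.
rewrite inE => Am.
have := is_derive_mulr (is_derive_cstr (lagrange_coef R m) x)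
  (@is_derive_dpmono taylor_coef x (coef_derivation (taylor_coef x)) m _).
rewrite mul0r add0r; apply => p pm; apply: is_derive_taylor_coef => //.
by apply: leq_ltn_trans kn; exact: An_bound Am pm.
Qed.

(** The induction starts at 2 because [An 1] is empty while [y' = q] need not
    vanish. *)
Lemma Derive_n_implicit x k : D x -> (k <= n)%N ->
  ex_derive_n y k x /\
  ((2 <= k)%N -> Derive_n y k x = k`!%:R * lagrange_sum (taylor_coef x) k).
Proof.
elim: k x => [|[|[|k]] IH] x Dx kn; first by [].
- by split=> //; exists (q x); apply: is_derive_y.
- have H : is_derive (Derive_n y 1) x (- (C 2 0 0 x / P 0 1 x)).
    apply: (is_derive_ext_loc q); last exact: is_derive_slope.
    apply: filter_imp (openD Dx) => t Dt; apply/esym.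
    exact: is_derive_unique (is_derive_y Dt).
  split=> [|_]; first by eexists; exact: H.
  rewrite /= (is_derive_unique _ _ _ H) lagrange_sum2 /taylor_coef /=.
  have [f2 f0] : [/\ 2`!%:R = 2 :> R & 0`!%:R = 1 :> R] by [].
  by rewrite f2 f0; move: (P 2 0 x + _ + _) (P01_neq0 Dx) => c P0; field.
- have H : is_derive (Derive_n y k.+2) x
      (k.+3`!%:R * lagrange_sum (taylor_coef x) k.+3).
    apply: (is_derive_ext_loc (fun t => k.+2`!%:R * lagrange_sum (taylor_coef t) k.+2)).
      by apply: filter_imp (openD Dx) => t Dt; have [_ ->] := IH t Dt (ltnW kn).
    have -> : k.+3`!%:R * lagrange_sum (taylor_coef x) k.+3 =
      0 * lagrange_sum (taylor_coef x) k.+2 +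
      k.+2`!%:R * (k.+3%:R * lagrange_sum (taylor_coef x) k.+3).
      by rewrite mul0r add0r factS natrM mulrA (mulrC _%:R).
    exact: is_derive_mulr (is_derive_cstr _ x) (is_derive_lagrange_sum _ _).
  split=> [|_]; first by eexists; exact: H.
  exact: is_derive_unique H.
Qed.

Lemma frozen_derivativeE l i j x : C l i j x =
  \sum_(t < l.+1) 'C(l, t)%:R * q x ^+ t * P (l - t + i) (t + j) x.
Proof.
elim: l i j => [|l IH] i j.
  by rewrite big_ord1 bin0 mulr1 mul1r.
rewrite [LHS]/= !IH [in RHS]big_ord_recl [X in X + _ = _]big_ord_recl /=.
rewrite !bin0 !subn0 addnS addSn -addrA; congr (_ + _).
(* Pascal's rule, the summand of index 0 being split off on both sides. *)
under [in RHS]eq_bigr => t _ do rewrite /bump /= binS natrD 2!mulrDl subSS.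
rewrite big_split [X in _ = X + _]big_ord_recr /= bin_small // !mul0r addr0.
congr (_ + _).
  apply: eq_bigr => t _; rewrite /bump /=; congr (_ * P _ _ x).
  by rewrite addnS -addSn -subSn // ltn_ord.
rewrite mulr_sumr; apply: eq_bigr => t _.
by rewrite addnS addSn exprS; ring.
Qed.

End AlongCurve.

(** * The derivatives of an implicit function *)

Definition along (f : R -> R -> R) (y : R -> R) (i j : nat) (x : R) : R :=
  partial_derive i j f x (y x).

(** [Delta_l] is [(f_y d_x - f_x d_y)^l] with frozen coefficients, that is
    [f_y ^ l (d_x + q d_y)^l]. *)
Lemma Delta_frozen (f : R -> R -> R) (y : R -> R) x l r :
  along f y 0 1 x != 0 ->
  Delta f l (partial_derive 0 r f) x (y x) =
    along f y 0 1 x ^+ l * frozen_derivative (along f y) l 0 r x.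
Proof.
move=> fy0; rewrite frozen_derivativeE mulr_sumr; apply: eq_bigr => j _.
rewrite partial_derive_add_zero; last by right.
rewrite -/(along f y 1 0 x) -/(along f y 0 1 x) !plusE addn0.
rewrite -[partial_derive _ _ _ _ _]/(along f y (l - j) (j + r) x).
have jl : (j <= l)%N by rewrite -ltnS.
have -> : along f y 0 1 x ^+ l = along f y 0 1 x ^+ (l - j) * along f y 0 1 x ^+ j.
  by rewrite -exprD subnK.
rewrite expr_div_n [(- along _ _ _ _ _) ^+ j]exprNn.
have : along f y 0 1 x ^+ j != 0 by rewrite expf_neq0.
move: (along f y 0 1 x ^+ j) (along f y 0 1 x ^+ (l - j)) => a b a0.
move: (along f y 1 0 x ^+ j) (along f y (l - j) (j + r) x) => c d.
by move: ((-1) ^+ j) ('C(l, j)%:R) => s w; field.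
Qed.

(** Each [Delta_l f_(y^r)] contributes [f_y ^ l], and each factor [a p] one more
    [f_y] in the denominator; in total this is [f_y ^ (n + |m|)]. *)
Lemma implicit_termE (f : R -> R -> R) (y : R -> R) n (m : {mset nat * nat}) x :
  along f y 0 1 x != 0 -> An n m ->
  implicit_term f n m x (y x) =
    n`!%:R * (lagrange_coef R m * dpmono (taylor_coef (along f y) x) m).
Proof.
move=> fy0 /AnP[_ Hl _].
rewrite /implicit_term /lagrange_coef -/(weight snd m) -size_mset.
have -> : dpmono (taylor_coef (along f y) x) m =
    (\prod_(p <- finsupp m) Delta f p.1 (partial_derive 0 p.2 f) x (y x) ^+ m p) /
    (\prod_(p <- finsupp m) (p.1`! ^ m p * p.2`! ^ m p * (m p)`!))%N%:R /
    along f y 0 1 x ^+ (n + size m).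
  rewrite -Hl size_mset /weight -big_split /= -prodrXr natr_prod -!prodf_div.
  apply: eq_bigr => p _; rewrite Delta_frozen // /taylor_coef.
  rewrite !natrM !natrX exprMn exprVn !exprMn exprD exprM !invfM.
  have : along f y 0 1 x ^+ p.1 ^+ m p != 0 by rewrite !expf_neq0.
  move: (along f y 0 1 x ^+ p.1 ^+ m p) (along f y 0 1 x ^- m p) => z t z0.
  move: (frozen_derivative _ _ _ _ _ ^+ _) (p.1`!%:R ^- m p) (p.2`!%:R ^- m p) => c v w.
  by move: ((m p)`!%:R^-1) => h; field.
rewrite -/(along f y 0 1 x).
move: (\prod_(p <- _) _ : R) (n`!%:R) ((weight snd m)`!%:R) => a b c.
by move: ((\prod_(p <- _) _)%N%:R^-1) (_ ^- (n + size m)) (_ ^+ size m) => d e s; ring.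
Qed.

Lemma implicit_neighborhood (n : nat) (f : R -> R -> R) (x0 y0 : R) (y : R -> R) :
  (1 <= n)%N -> locally_2d (ex_diff_n f n) x0 y0 ->
  partial_derive 0 1 f x0 y0 <> 0 -> implicit_function f x0 y0 y ->
  locally x0 (fun x =>
    [/\ locally_2d (ex_diff_n f n) x (y x), along f y 0 1 x != 0 &
        is_derive y x (- along f y 1 0 x / along f y 0 1 x)]).
Proof.
move=> n1 Hf fy0 [yx0 cy fxy].
have Hf0 := locally_2d_singleton _ _ _ Hf.
have n0 : (0 + 0 < n)%coq_nat by apply/ltP.
have cfx := ex_diff_n_continuity_inf_1 _ 0 0 n0 _ _ _ Hf0.
have cfy := ex_diff_n_continuity_inf_2 _ 0 0 n0 _ _ _ Hf0.
have c0 : Rlt 0 (Rabs (partial_derive 0 1 f x0 y0) / 2).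
  by have := Rabs_pos_lt _ fy0; lra.
have [r1 Hr1] := cfx (mkposreal _ Rlt_0_1).
have [r2 Hr2] := cfy (mkposreal _ c0).
have [r3 Hr3] := Hf.
pose r := Rmin r1 (Rmin r2 r3).
have r0 : Rlt 0 r by repeat apply: Rmin_pos; exact: cond_pos.
have [rr1 rr2 rr3] : [/\ Rle r r1, Rle r r2 & Rle r r3].
  split; [exact: Rmin_l|apply: Rle_trans (Rmin_r _ _) _; exact: Rmin_l|].
  apply: Rle_trans (Rmin_r _ _) _; exact: Rmin_r.
have box u v : Rlt (Rabs (u - x0)) r -> Rlt (Rabs (v - y0)) r ->
    [/\ ex_derive (fun s => f s v) u, ex_derive (fun s => f u s) v,
        Rle (Rabs (Derive (fun s => f s v) u)) (Rabs (partial_derive 1 0 f x0 y0) + 1)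
      & Rle (Rabs (partial_derive 0 1 f x0 y0) / 2) (Rabs (Derive (fun s => f u s) v))].
  move=> ur vr.
  have Huv := Hr3 u v (Rlt_le_trans _ _ _ ur rr3) (Rlt_le_trans _ _ _ vr rr3).
  split.
  - exact: ex_diff_n_ex_deriv_inf_1 n0 _ _ _ Huv.
  - exact: ex_diff_n_ex_deriv_inf_2 n0 _ _ _ Huv.
  - have := Hr1 u v (Rlt_le_trans _ _ _ ur rr1) (Rlt_le_trans _ _ _ vr rr1).
    rewrite /partial_derive /= => H.
    by move: (Derive _ u) (Derive _ x0) H => a b; split_Rabs; lra.
  - have := Hr2 u v (Rlt_le_trans _ _ _ ur rr2) (Rlt_le_trans _ _ _ vr rr2).
    rewrite /partial_derive /= => H.
    by move: (Derive _ v) (Derive _ y0) H => a b; split_Rabs; lra.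
have loc_r : locally x0 (fun x =>
    Rlt (Rabs (x - x0)) r /\ Rlt (Rabs (y x - y0)) r /\ f x (y x) = 0).
  apply: filter_and; first by apply: locally_Rabs; rewrite Rminus_diag Rabs_R0.
  apply: filter_and fxy; apply: (cy (fun v => Rlt (Rabs (v - y0)) r)); rewrite yx0.
  by apply: locally_Rabs; rewrite Rminus_diag Rabs_R0.
have [rho rho0 Hrho] := locally_Rabs_ex loc_r.
apply: (locally_Rabs_imp rho0) => x xrho.
have [xr [yr fx]] := Hrho x xrho.
have Hx : locally_2d (ex_diff_n f n) x (y x).
  have dx : Rlt 0 (Rmin (r - Rabs (x - x0)) (r - Rabs (y x - y0))).
    by apply: Rmin_pos; lra.
  exists (mkposreal _ dx) => u v /= ux vy; apply: Hr3.
    apply: Rlt_le_trans rr3; have := Rlt_le_trans _ _ _ ux (Rmin_l _ _).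
    by move: xr; split_Rabs; lra.
  apply: Rlt_le_trans rr3; have := Rlt_le_trans _ _ _ vy (Rmin_r _ _).
  by move: yr; split_Rabs; lra.
have fyx : partial_derive 0 1 f x (y x) <> 0.
  have [_ _ _ le_c] := box _ _ xr yr => E.
  have : Rle (Rabs (partial_derive 0 1 f x0 y0) / 2)
    (Rabs (partial_derive 0 1 f x (y x))) := le_c.
  by rewrite E Rabs_R0; lra.
split=> //; first exact/eqP.
have box' u v : Rlt (Rabs (u - x0)) rho -> Rlt (Rabs (v - y0)) r -> _ :=
  fun ur vr => box u v (proj1 (Hrho u ur)) vr.
have lip := implicit_lipschitz c0 box' (fun t tr => proj2 (Hrho t tr)).
have f_diff := differentiable_partial_derive (i := 0) (j := 0) n1 Hx.
apply: (is_derive_implicit _ fyx _ f_diff).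
  by apply: filter_imp (locally_Rabs xrho) => t /Hrho[_ []].
by apply: filter_imp (locally_Rabs xrho) => t tr; apply: lip.
Qed.

Theorem theorem15 (n : nat) (f : R -> R -> R) (x0 y0 : R) (y : R -> R)
    (hn : (2 <= n)%N)
    (hf : locally_2d (fun u v => ex_diff_n f n u v) x0 y0)
    (hf0 : f x0 y0 = 0)
    (hfy : partial_derive 0 1 f x0 y0 <> 0)
    (hy : implicit_function f x0 y0 y) :
  locally x0 (fun x =>
    (forall k : nat, (k <= n)%N -> ex_derive_n y k x) /\
    Derive_n y n x = \sum_(m \in An n) implicit_term f n m x (y x)).
Proof.
have [rho rho0 Hrho] := locally_Rabs_ex (implicit_neighborhood (ltnW hn) hf hfy hy).
pose D (x : R) := Rlt (Rabs (x - x0)) rho.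
have openD x : D x -> locally x D by exact: locally_Rabs.
have fy_neq0 x : D x -> along f y 0 1 x != 0 by move=> /Hrho[].
have is_derive_y x : D x -> is_derive y x (- along f y 1 0 x / along f y 0 1 x)%R.
  by move=> /Hrho[].
have is_derive_along x i j : D x -> (i + j < n)%N ->
    is_derive (along f y i j) x (along f y i.+1 j x +
      (- along f y 1 0 x / along f y 0 1 x) * along f y i j.+1 x)%R.
  move=> Dx ij_n; have [Hx _ _] := Hrho x Dx.
  rewrite [X in (_ + X)%R]mulrC.
  exact: chain_rule_2d (differentiable_partial_derive ij_n Hx) (is_derive_y x Dx).
have main x k (Dx : D x) (kn : (k <= n)%N) :=
  Derive_n_implicit hn openD fy_neq0 is_derive_along is_derive_y Dx kn.
apply: (locally_Rabs_imp rho0) => x Dx; split=> [k kn|].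
  by have [] := main x k Dx kn.
have [_ ->//] := main x n Dx (leqnn n).
rewrite /lagrange_sum mulr_fsumr; apply: eq_fsbigr => m; rewrite inE => Am.
by rewrite implicit_termE //; exact: fy_neq0.
Qed.
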